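(* In the sampling framework described in the context, suppose that, given $\{(X_i',D_i)'\}_{i\in\mathcal S}=\{(x_i',d_i)'\}_{i\in\mathcal S}$: (1) $\mathcal S^*\subseteq\mathcal S$, the covariate function $s$ and the conditional distribution $F$ are functions of $\{(X_i',D_i)'\}_{i\in\mathcal S}$; (2) $\lim_{|\mathcal S|\to\infty}|\mathcal S^*|=\infty$; (3) for each $d\in\{0,1\}$, $\mathbf E_F[\|ZU\|^2|X=\cdot,D=d]$ is bounded on $\mathbb X^{*d}$ by a fixed constant; (4) for some fixed constant $\underline\lambda>0$, $\liminf_{|\mathcal S|\to\infty}\lambda_{\min}[\Gamma^*]\ge\underline\lambda$. Then $\hat\theta^*$ converges in conditional probability to $\theta_{\mathbb G^*,F}$: for every $\eta>0$, $$\mathbf{Pr}_F\bigl[\|\hat\theta^*-\theta_{\mathbb G^*,F}\|>\eta\bigm|\{(X_i',D_i)'\}_{i\in\mathcal S}\bigr]\to0$$ given $\{(X_i',D_i)'\}_{i\in\mathcal S}=\{(x_i',d_i)'\}_{i\in\mathcal S}$, as $|\mathcal S|\to\infty$.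
   Context: For each sample size $|\mathcal S|$ there is a finite random sample $\mathcal S$ of units $i$ with $Y_i\in\mathbb R$, $X_i\in\mathbb R^p$, $D_i\in\{0,1\}$. $F$ is the conditional distribution of $Y$ given $(X',D)'$ (a kernel), which may depend on $\{(X_i',D_i)'\}_{i\in\mathcal S}$; conditionally on $\{(X_i',D_i)'\}_{i\in\mathcal S}$ the $Y_i$ are independent with $Y_i\sim F(\cdot|X_i,D_i)$ (a triangular array as $|\mathcal S|$ varies). The values $\{(x_i',d_i)'\}_{i\in\mathcal S}$ are fixed realizations; $\mathbf{Pr}_F[\cdot|\{(X_i',D_i)'\}_{i\in\mathcal S}]$ and $\mathbf E_F$ refer to the randomness of the $Y_i$ under $F$. ''Fixed constant'' means not depending on $|\mathcal S|$. $\mathcal S^*\subseteq\mathcal S$ is a subsample, $\mathcal S^{*d}=\{i\in\mathcal S^*:D_i=d\}$, $\mathbb X^{*d}=\{X_i:i\in\mathcal S^{*d}\}$, and $\mathbb G^*$ is the empirical distribution of $(X_i',D_i)'$ within $\mathcal S^*$. $s$ maps $\mathbb R^p$ to a Euclidean space of fixed dimension; $Z=(1,D,s(X)')'$, $Z_i=(1,D_i,s(X_i)')'$; $U=Y-\mathbf E_F[Y|X,D]$. Define $\Gamma^*=|\mathcal S^*|^{-1}\sum_{i\in\mathcal S^*}Z_iZ_i'$, $$\hat\theta^*=(\Gamma^* )^{-1}\frac1{|\mathcal S^*|}\sum_{i\in\mathcal S^*}Z_iY_i,\qquad \theta_{\mathbb G^*,F}=(\Gamma^* )^{-1}\frac1{|\mathcal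 S^*|}\sum_{i\in\mathcal S^*}Z_i\,\mathbf E_F[Y|X=X_i,D=D_i].$$ $\lambda_{\min}[A]$ is the smallest eigenvalue of a symmetric positive semi-definite matrix $A$. *)

(* Defs.v *)
From mathcomp Require Import all_boot all_order all_algebra.
From mathcomp Require Import all_classical all_reals all_analysis.

Set Implicit Arguments.
Unset Strict Implicit.
Unset Printing Implicit Defensive.

Import Order.TTheory GRing.Theory Num.Theory.
Import numFieldNormedType.Exports.

Local Open Scope classical_set_scope.
Local Open Scope ring_scope.

(* The library norm on matrices is the sup norm. *)
Definition enorm (R : realType) (k : nat) (v : 'cV[R]_k) : R :=
  Num.sqrt (\sum_(i < k) v i 0 ^+ 2).

(* Meant for symmetric A of positive size, whose set of eigenvalues is finite
   and nonempty, so that the infimum is a minimum. *)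
Definition lambda_min (R : realType) (k : nat) (A : 'M[R]_k) : R :=
  inf [set a : R | eigenvalue A a].

Definition mutually_independent (R : realType) (d : measure_display)
    (T : measurableType d) (P : probability T R) (n : nat)
    (Y : 'I_n -> {RV P >-> R}) : Prop :=
  forall (J : {set 'I_n}) (B : 'I_n -> set R),
    (forall i, measurable (B i)) ->
    P (\bigcap_(i in [set j | j \in J]) (Y i @^-1` B i)) =
    (\prod_(i in J) P (Y i @^-1` B i))%E.

(* A value (x, d) of the pair (X, D); the boolean is true iff d = 1. *)
Notation covariate R p := (p.-tuple R * bool)%type.

(* The values taken by the pairs (X_i, D_i) over a sample of n units. *)
Definition design (R : realType) (p n : nat) : Type := 'I_n -> covariate R p.

Section estimator.
Context (R : realType) (p q : nat).
Implicit Types (s : p.-tuple R -> 'cV[R]_q) (c : covariate R p)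
  (F : R.-pker (covariate R p) ~> R).

(* Z = (1, D, s(X)')' *)
Definition regressor s c : 'cV[R]_(1 + (1 + q)) :=
  col_mx (const_mx 1) (col_mx (const_mx (c.2%:R)) (s c.1)).

(* E_F[Y | (X, D) = c] *)
Definition cond_mean F c : R := (\int[F c]_y y)%R.

(* E_F[||Z U||^2 | (X, D) = c], with U = Y - E_F[Y | X, D]. Its finiteness
   forces Y to be square integrable under F c, because ||Z|| >= 1 and
   cond_mean F c is a real number in all cases. *)
Definition cond_score2 s F c : \bar R :=
  (\int[F c]_y ((enorm ((y - cond_mean F c) *: regressor s c) ^+ 2)%:E))%E.

Section subsample.
Context (n : nat).
Implicit Types (w : design R p n) (S : {set 'I_n}) (y : 'I_n -> R).

Definition treatment_covariates w S (b : bool) : set (p.-tuple R) :=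
  [set (w i).1 | i in [set i | i \in S /\ (w i).2 = b]].

Definition Gamma s w S : 'M[R]_(1 + (1 + q)) :=
  #|S|%:R^-1 *: \sum_(i in S) (regressor s (w i) *m (regressor s (w i))^T).

Definition theta_hat s w S y : 'cV[R]_(1 + (1 + q)) :=
  invmx (Gamma s w S) *m
    (#|S|%:R^-1 *: \sum_(i in S) (y i *: regressor s (w i))).

(* The empirical distribution of the covariates in the subsample enters
   through w and S. *)
Definition theta s w S F : 'cV[R]_(1 + (1 + q)) :=
  invmx (Gamma s w S) *m
    (#|S|%:R^-1 *: \sum_(i in S) (cond_mean F (w i) *: regressor s (w i))).

End subsample.
End estimator.

(* Main.v *)
(* theta_hat - theta = sum_i U_i v_i with v_i = Gamma^-1 Z_i / |S*|. Independence
   makes the U_i uncorrelated, so the mean squared norm of this sum is the sum of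
   the E |U_i v_i|^2. Since |Gamma^-1 z| <= |z| / lambda_min Gamma, each term is
   at most E |U_i Z_i|^2 / (lambda_min Gamma * |S*|)^2, so the sum is O(1 / |S*|),
   and Markov's inequality concludes. *)
Require Import Defs.
From mathcomp Require Import all_boot all_order all_algebra.
From mathcomp Require Import all_classical all_reals all_analysis.
From mathcomp Require Import measurable_realfun ring lra.
Import Order.TTheory GRing.Theory Num.Theory.
Import numFieldNormedType.Exports.
Local Open Scope classical_set_scope.
Local Open Scope ring_scope.

(** * Quadratic forms, the smallest eigenvalue and the norm of an inverse matrix *)

Definition bform {R : realType} {k : nat} (A : 'M[R]_k) (u v : 'cV[R]_k) : R :=
  (u^T *m A *m v) 0 0.

(** Symmetry is required separately because over the reals a nonnegative quadratic form does not
    force it. *)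
Definition psd {R : realType} {k : nat} (A : 'M[R]_k) : Prop :=
  A^T = A /\ forall v, 0 <= bform A v v.

Section quadratic_forms.
Context {R : realType} {k : nat}.
Implicit Types (A : 'M[R]_k) (u v : 'cV[R]_k).

Lemma sqr_enorm v : enorm v ^+ 2 = \sum_(i < k) v i 0 ^+ 2.
Proof. by rewrite sqr_sqrtr// sumr_ge0// => i _; exact: sqr_ge0. Qed.

Lemma bform1 v : bform 1%:M v v = enorm v ^+ 2.
Proof.
rewrite /bform mulmx1 sqr_enorm !mxE; apply: eq_bigr => i _.
by rewrite mxE expr2.
Qed.

Lemma sqr_enorm_eq0 v : (enorm v ^+ 2 == 0) = (v == 0).
Proof.
rewrite sqr_enorm psumr_eq0; last by move=> i _; exact: sqr_ge0.
apply/allP/eqP => [v0|-> i _]; last by rewrite /= mxE expr0n.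
apply/colP => i; rewrite mxE; apply/eqP; rewrite -sqrf_eq0.
exact: (v0 i (mem_index_enum i)).
Qed.

Lemma sqr_enorm0 : enorm (0 : 'cV[R]_k) ^+ 2 = 0.
Proof. by apply/eqP; rewrite sqr_enorm_eq0. Qed.

Lemma sqr_enorm_gt0 v : (0 < enorm v ^+ 2) = (v != 0).
Proof. by rewrite lt_neqAle sqr_ge0 eq_sym sqr_enorm_eq0 andbT. Qed.

Lemma sqr_enormZ (a : R) v : enorm (a *: v) ^+ 2 = a ^+ 2 * enorm v ^+ 2.
Proof.
rewrite !sqr_enorm mulr_sumr; apply: eq_bigr => i _.
by rewrite mxE exprMn.
Qed.

Lemma bformDl A u1 u2 v : bform A (u1 + u2) v = bform A u1 v + bform A u2 v.
Proof. by rewrite /bform linearD /= !mulmxDl mxE. Qed.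

Lemma bformDr A u v1 v2 : bform A u (v1 + v2) = bform A u v1 + bform A u v2.
Proof. by rewrite /bform mulmxDr mxE. Qed.

Lemma bformZl A a u v : bform A (a *: u) v = a * bform A u v.
Proof. by rewrite /bform linearZ /= -!scalemxAl mxE. Qed.

Lemma bformZr A a u v : bform A u (a *: v) = a * bform A u v.
Proof. by rewrite /bform -scalemxAr mxE. Qed.

Lemma bform_sym A u v : A^T = A -> bform A u v = bform A v u.
Proof.
move=> symA; rewrite /bform.
have -> : v^T *m A *m u = (u^T *m A *m v)^T.
  by rewrite !trmx_mul trmxK symA mulmxA.
by rewrite [RHS]mxE.
Qed.

Lemma bformB A B u v : bform (A - B) u v = bform A u v - bform B u v.
Proof. by rewrite /bform mulmxBr mulmxBl !mxE. Qed.

Lemma bform_scalar a v : bform a%:M v v = a * enorm v ^+ 2.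
Proof. by rewrite -bform1 /bform mulmx1 mul_mx_scalar -scalemxAl mxE. Qed.

(** The form at [u + t *: v] is a polynomial in [t] of degree at most 2 that is never negative.
    Since [A] may be singular, its leading coefficient may vanish for a nonzero [v]. *)
Lemma cauchy_schwarz_psd A u v : psd A ->
  bform A u v ^+ 2 <= bform A u u * bform A v v.
Proof.
move=> [symA A_ge0].
have q_ge0 t : 0 <= bform A u u + 2 * t * bform A u v + t ^+ 2 * bform A v v.
  have := A_ge0 (u + t *: v).
  rewrite !bformDl !bformDr !bformZl !bformZr (bform_sym A v u)//.
  by congr (0 <= _); ring.
have [c0|c0] := eqVneq (bform A v v) 0.
  have [b0|b0] := eqVneq (bform A u v) 0; first by rewrite b0 c0 expr0n mulr0.
  (* The polynomial is now affine with nonzero slope, and at this [t] it equals -1. *)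
  have := q_ge0 (- (bform A u u + 1) / (2 * bform A u v)).
  rewrite c0 mulr0 addr0.
  have -> : 2 * (- (bform A u u + 1) / (2 * bform A u v)) * bform A u v
    = - (bform A u u + 1) by field.
  by lra.
have c_gt0 : 0 < bform A v v by rewrite lt_neqAle eq_sym c0 A_ge0.
(* This [t] minimizes the quadratic. *)
have := q_ge0 (- bform A u v / bform A v v).
have -> : bform A u u + 2 * (- bform A u v / bform A v v) * bform A u v +
    (- bform A u v / bform A v v) ^+ 2 * bform A v v =
    (bform A u u * bform A v v - bform A u v ^+ 2) / bform A v v by field.
by rewrite pmulr_lge0 ?invr_gt0// subr_ge0.
Qed.

(** Each product of two coordinates of [v] is at most [enorm v ^+ 2] in absolute value, so the sum
    of the absolute entries of [A] is a valid factor. Adding 1 makes it positive even when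
    [A = 0]. *)
Lemma bform_bounded A :
  exists2 K : R, 0 < K & forall v, bform A v v <= K * enorm v ^+ 2.
Proof.
exists (1 + \sum_i \sum_j `|A i j|).
  by rewrite ltr_pwDl// !sumr_ge0// => i _; rewrite sumr_ge0.
move=> v; rewrite mulrDl mul1r -[leLHS]add0r lerD ?sqr_ge0//.
have v_le i : v i 0 ^+ 2 <= enorm v ^+ 2.
  by rewrite sqr_enorm (bigD1 i)//= lerDl sumr_ge0// => j _; exact: sqr_ge0.
have v_abs i : `|v i 0| ^+ 2 <= enorm v ^+ 2 by rewrite real_normK ?num_real.
have -> : bform A v v = \sum_i \sum_j v i 0 * A i j * v j 0.
  rewrite /bform mxE exchange_big /=; apply: eq_bigr => j _.
  by rewrite mxE mulr_suml; apply: eq_bigr => i _; rewrite mxE.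
rewrite mulr_suml; apply: ler_sum => i _.
rewrite mulr_suml; apply: ler_sum => j _.
rewrite (le_trans (ler_norm _))// mulrAC normrM [leLHS]mulrC.
apply: ler_wpM2l => //.
rewrite normrM.
have := v_abs i; have := v_abs j.
have := sqr_ge0 (`|v i 0| - `|v j 0|).
by rewrite sqrrB; lra.
Qed.

(** Cauchy-Schwarz for [v] and [w = invmx A *m v] gives |v|^4 <= v'Av * v'w, and v'w is at most K
    |v|^2 by boundedness of the inverse. Hence 1 / K is a coercivity constant. *)
Lemma psd_unit_coercive A : psd A -> A \in unitmx ->
  exists2 c : R, 0 < c & forall v, c * enorm v ^+ 2 <= bform A v v.
Proof.
move=> psdA unitA; have [K K0 KP] := bform_bounded (invmx A).
exists K^-1; rewrite ?invr_gt0// => v.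
have [->|v0] := eqVneq v 0.
  by rewrite sqr_enorm0 mulr0; apply: psdA.2.
have := cauchy_schwarz_psd A v (invmx A *m v) psdA.
have -> : bform A v (invmx A *m v) = enorm v ^+ 2.
  by rewrite -bform1 /bform mulmxA mulmxK// mulmx1.
have -> : bform A (invmx A *m v) (invmx A *m v) = bform (invmx A) v v.
  by rewrite /bform trmx_mul trmx_inv psdA.1 mulmxKV// mulmxA.
move=> cs; rewrite ler_pdivrMl//.
have v_gt0 : 0 < enorm v ^+ 2 by rewrite sqr_enorm_gt0.
rewrite -(ler_pM2r v_gt0) -expr2 (le_trans cs)//.
by rewrite mulrAC [leRHS]mulrC ler_wpM2l// psdA.2.
Qed.

Lemma unitmxPn_eigenvalue A a : A - a%:M \notin unitmx = eigenvalue A a.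
Proof. by rewrite /eigenvalue kermx_eq0 row_free_unit. Qed.

(** At an eigenvector the form equals [a] times the squared norm. Eigenvectors are rows here, hence
    the transposes. *)
Lemma eigenvalue_psd_ge0 A a : psd A -> eigenvalue A a -> 0 <= a.
Proof.
move=> [_ A_ge0] /eigenvalueP[u uA u0].
have := A_ge0 u^T; rewrite /bform trmxK uA -scalemxAl mxE.
have -> : (u *m u^T) 0 0 = enorm u^T ^+ 2 by rewrite -bform1 /bform mulmx1 trmxK.
by rewrite pmulr_lge0// sqr_enorm_gt0 trmx_eq0.
Qed.

Lemma lambda_min_le_eigenvalue A a : psd A -> eigenvalue A a ->
  lambda_min A <= a.
Proof.
move=> psdA Aa; apply: ge_inf => //.
by exists 0 => b /= Ab; exact: eigenvalue_psd_ge0 Ab.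
Qed.

End quadratic_forms.

(* The largest t such that A - t I is positive semi-definite is an eigenvalue of
   A: otherwise A - t I would be invertible, hence coercive, and t could be
   increased. *)
Lemma lambda_min_rayleigh {R : realType} {k : nat} (A : 'M[R]_k.+1)
    (v : 'cV[R]_k.+1) : psd A -> lambda_min A * enorm v ^+ 2 <= bform A v v.
Proof.
move=> psdA.
pose T := [set t : R | forall v, t * enorm v ^+ 2 <= bform A v v].
have T0 : T 0 by move=> u; rewrite mul0r psdA.2.
(* Positive size provides a unit vector, and the form at this vector bounds [T] from above. *)
pose e0 : 'cV[R]_k.+1 := delta_mx 0 0.
have e01 : enorm e0 ^+ 2 = 1.
  rewrite sqr_enorm big_ord_recl big1 => [|i _]; rewrite !mxE//=.
    by rewrite addr0 expr1n.
  by rewrite expr0n.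
have supT : has_sup T.
  by split; [exists 0 | exists (bform A e0 e0) => t /(_ e0); rewrite e01 mulr1].
(* The supremum is attained: for each nonzero [u] the constraint on [t] is a non-strict upper bound,
   which passes to the supremum. *)
have Tsup : T (sup T).
  move=> u; have [->|u0] := eqVneq u 0.
    by rewrite sqr_enorm0 mulr0; apply: psdA.2.
  have u_gt0 : 0 < enorm u ^+ 2 by rewrite sqr_enorm_gt0.
  rewrite -ler_pdivlMr//; apply: sup_le_ub; first exact: supT.1.
  by move=> t /(_ u); rewrite ler_pdivlMr.
have psdB : psd (A - (sup T)%:M).
  split; first by rewrite linearB /= psdA.1 tr_scalar_mx.
  by move=> u; rewrite bformB bform_scalar subr_ge0.
have [|/negbTE nunit] := boolP (A - (sup T)%:M \in unitmx).
  move=> /(psd_unit_coercive _ psdB)[c c0 cP]; exfalso.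
  have : T (sup T + c).
    move=> u; have := cP u; rewrite bformB bform_scalar mulrDl.
    by rewrite lerBrDl.
  by move=> /(sup_upper_bound supT); rewrite gerDl leNgt c0.
apply: le_trans (Tsup v); apply: ler_wpM2r; first exact: sqr_ge0.
by apply: lambda_min_le_eigenvalue => //; rewrite -unitmxPn_eigenvalue nunit.
Qed.

(** A singular matrix has the eigenvalue 0, which is then an upper bound of [lambda_min]. *)
Lemma unitmx_lambda_min {R : realType} {k : nat} (A : 'M[R]_k) : psd A ->
  0 < lambda_min A -> A \in unitmx.
Proof.
move=> psdA; apply: contraTT => nunit.
by rewrite -leNgt lambda_min_le_eigenvalue// -unitmxPn_eigenvalue raddf0 subr0.
Qed.

(** With x = A^-1 z, the Rayleigh bound gives l |x|^2 <= x'Ax = x'z. Squaring and applying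
    Cauchy-Schwarz gives l^2 |x|^4 <= |x|^2 |z|^2, and |x|^2 cancels. *)
Lemma sqr_enorm_invmx_le {R : realType} {k : nat} (A : 'M[R]_k.+1)
    (l : R) (z : 'cV[R]_k.+1) : psd A -> 0 < l -> l <= lambda_min A ->
  enorm (invmx A *m z) ^+ 2 <= l ^- 2 * enorm z ^+ 2.
Proof.
move=> psdA l0 lA.
have unitA : A \in unitmx.
  by apply: unitmx_lambda_min => //; exact: lt_le_trans lA.
set x := invmx A *m z.
have [->|x0] := eqVneq x 0.
  by rewrite sqr_enorm0 mulr_ge0 ?invr_ge0 ?sqr_ge0.
have x_gt0 : 0 < enorm x ^+ 2 by rewrite sqr_enorm_gt0.
have psd1 : psd (1%:M : 'M[R]_k.+1).
  by split; [rewrite tr_scalar_mx | move=> v; rewrite bform1 sqr_ge0].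
have Axx : bform A x x = bform 1%:M x z.
  by rewrite /bform mulmx1 -mulmxA mulKVmx.
have lx : l * enorm x ^+ 2 <= bform 1%:M x z.
  rewrite -Axx (le_trans _ (lambda_min_rayleigh A x psdA))//.
  by rewrite ler_wpM2r// sqr_ge0.
have := cauchy_schwarz_psd _ x z psd1; rewrite !bform1 => cs.
rewrite ler_pdivlMl ?exprn_gt0// -(ler_pM2l x_gt0) (le_trans _ cs)//.
apply: (@le_trans _ _ ((l * enorm x ^+ 2) ^+ 2)); first by rewrite exprMn; lra.
have lx_ge0 : 0 <= l * enorm x ^+ 2 by rewrite mulr_ge0 ?sqr_ge0// ltW.
by rewrite lerXn2r// nnegrE// (le_trans lx_ge0).
Qed.

(** The form at [v] is the average over [S] of the squares of Z_i'v. *)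
Lemma psd_Gamma {R : realType} {p q n : nat} (s : p.-tuple R -> 'cV[R]_q)
    (w : design R p n) (S : {set 'I_n}) : psd (Gamma s w S).
Proof.
split.
  rewrite /Gamma linearZ /= linear_sum /=; congr (_ *: _).
  by apply: eq_bigr => i _; rewrite trmx_mul trmxK.
move=> v; rewrite /bform /Gamma -scalemxAr -scalemxAl mulmx_sumr mulmx_suml.
rewrite mxE mulr_ge0 ?invr_ge0 ?ler0n// summxE sumr_ge0// => i _.
set u := (regressor s (w i))^T *m v.
have -> : v^T *m (regressor s (w i) *m (regressor s (w i))^T) *m v = u^T *m u.
  by rewrite trmx_mul trmxK !mulmxA.
by rewrite mxE sumr_ge0// => j _; rewrite mxE -expr2 sqr_ge0.
Qed.

(** * Square integrability and second moments of independent variables *)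

Lemma integrable_sqr_Lfun2 {d} {T : measurableType d} {R : realType}
    (mu : {measure set T -> \bar R}) (f : T -> R) :
  measurable_fun [set: T] f ->
  mu.-integrable [set: T] (fun x => (f x ^+ 2)%:E) -> f \in Lfun mu 2%:E.
Proof.
move=> mf /integrableP[_ f2_lty]; rewrite inE; apply/andP; split; rewrite inE//=.
rewrite /finite_norm unlock poweR_lty// (le_lt_trans _ f2_lty)//.
rewrite le_eqVlt; apply/orP; left; apply/eqP; apply: eq_integral => x _.
by rewrite /= normrX powR_mulrn.
Qed.

(* The joint law of independent variables is the product of their laws, so that
   Fubini's theorem applies. *)
Lemma expectation_mul_independent {d} {T : measurableType d} {R : realType}
    (P : probability T R) (X Y : {RV P >-> R}) :
  (forall A B : set R, measurable A -> measurable B ->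
     P (X @^-1` A `&` Y @^-1` B) = (P (X @^-1` A) * P (Y @^-1` B))%E) ->
  (X : T -> R) \in Lfun P 1 -> (Y : T -> R) \in Lfun P 1 ->
  (X \* Y) \in Lfun P 1 -> 'E_P[X \* Y]%E = ('E_P[X] * 'E_P[Y])%E.
Proof.
move=> indep L1X L1Y L1XY.
have mXY : measurable_fun [set: T] (fun t => (X t, Y t) : (R * R)%type).
  exact: measurable_fun_pair.
pose XY : {mfun T >-> (R * R)%type} :=
  MeasurableFun.Pack (MeasurableFun.Class (isMeasurableFun.Build _ _ _ _ _ mXY)).
pose f (z : R * R) := (z.1 * z.2)%:E.
have mf : measurable_fun setT f.
  by apply/measurable_EFinP; apply: measurable_funM.
have fXY : f \o XY = EFin \o (X \* Y) by [].
have intfXY : P.-integrable [set: T] (f \o XY).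
  by rewrite fXY; exact/Lfun1_integrable.
(* Independence says that the two laws agree on measurable rectangles, which determine the product
   measure. *)
have lawE (C : set (R * R)) : measurable C ->
    distribution P XY C = (distribution P X \x distribution P Y)%E C.
  by move=> mC; apply/esym; exact: product_measure_unique.
(* Fubini's theorem asks for integrability under the product law; it is inherited from the joint
   law. *)
have intf : (distribution P X \x distribution P Y)%E.-integrable setT f.
  have /integrableP[_ lty] := integrable_pushforward mXY mf intfXY measurableT.
  apply/integrableP; split => //; apply: le_lt_trans lty.
  rewrite le_eqVlt; apply/orP; left; apply/eqP.
  by apply: eq_measure_integral => C mC _; exact/esym/lawE.
have -> : 'E_P[X \* Y]%E = (\int[distribution P XY]_z f z)%E.
  by rewrite integral_distribution// unlock.
rewrite (eq_measure_integral (distribution P X \x distribution P Y)%E); last first.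
  by move=> C mC _; exact: lawE.
rewrite -integral12_prod_meas1//.
have EY : (\int[distribution P Y]_y y%:E)%E = 'E_P[Y]%E.
  rewrite integral_distribution//; first by rewrite expectation_def.
  by apply/Lfun1_integrable.
have EX : (\int[distribution P X]_y y%:E)%E = 'E_P[X]%E.
  rewrite integral_distribution//; first by rewrite expectation_def.
  by apply/Lfun1_integrable.
have iX : (distribution P X).-integrable setT (EFin : R -> \bar R).
  apply: integrable_pushforward => //.
  by apply/Lfun1_integrable.
have iY : (distribution P Y).-integrable setT (EFin : R -> \bar R).
  apply: integrable_pushforward => //.
  by apply/Lfun1_integrable.
transitivity (\int[distribution P X]_x (x%:E * 'E_P[Y]))%E.
  apply: eq_integral => x _; rewrite /fubini_F /f /=.
  by under eq_integral do rewrite EFinM; rewrite integralZl// EY.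
by rewrite -(fineK (expectation_fin_num L1Y)) integralZr// EX.
Qed.

Lemma measurable_enorm_sum {d} {T : measurableType d} {R : realType} {k m : nat}
    (U : 'I_m -> T -> R) (v : 'I_m -> 'cV[R]_k) :
  (forall i, measurable_fun [set: T] (U i)) ->
  measurable_fun [set: T] (fun t => enorm (\sum_i U i t *: v i)).
Proof.
move=> mU; have msqrt : measurable_fun [set: R] (@Num.sqrt R).
  by apply: continuous_measurable_fun; exact: sqrt_continuous.
apply: (measurableT_comp msqrt).
apply: measurable_sum => j; apply: measurable_funX.
under eq_fun do rewrite summxE.
apply: measurable_sum => i.
under eq_fun do rewrite mxE.
by apply: measurable_funM.
Qed.

(** The squared norm expands into a double sum of U_i U_j <v_i, v_j>. Square integrability allows
    integration term by term, and orthogonality leaves only the diagonal. *)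
Lemma expectation_sqr_enorm_sum {d} {T : measurableType d} {R : realType}
    (P : probability T R) {k m : nat} (U : 'I_m -> T -> R)
    (v : 'I_m -> 'cV[R]_k) :
  (forall i, U i \in Lfun P 2%:E) ->
  (forall i j, i != j -> 'E_P[U i \* U j]%E = 0%E) ->
  ('E_P[fun t => (enorm (\sum_i U i t *: v i) ^+ 2)%R] =
   \sum_i 'E_P[fun t => (enorm (U i t *: v i) ^+ 2)%R])%E.
Proof.
move=> L2U orth.
have L1UU i j : (U i \* U j) \in Lfun P 1 by exact: Lfun2_mul_Lfun1.
have iUU i j c : P.-integrable setT (fun t => (U i t * U j t * c)%:E).
  have : P.-integrable setT (EFin \o (U i \* U j)) by exact/Lfun1_integrable.
  by move=> /(integrableZr measurableT c).
have EUU i j c : (\int[P]_t (U i t * U j t * c)%R%:E = c%:E * 'E_P[U i \* U j])%E.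
  rewrite -expectationZl// unlock; apply: eq_integral => t _ /=.
  by rewrite mulrC.
(* The Gram matrix of the vectors [v i]. *)
pose g i j := bform 1%:M (v i) (v j).
have E t : enorm (\sum_i U i t *: v i) ^+ 2 =
    \sum_(ij : 'I_m * 'I_m) U ij.1 t * U ij.2 t * g ij.1 ij.2.
  rewrite -(pair_bigA _ (fun i j => U i t * U j t * g i j)) /= -bform1.
  have trE : (\sum_i U i t *: v i)^T = \sum_i (U i t *: v i)^T by rewrite linear_sum.
  rewrite /bform mulmx1 trE mulmx_suml summxE.
  apply: eq_bigr => i _; rewrite mulmx_sumr summxE; apply: eq_bigr => j _.
  have trZ : (U i t *: v i)^T = U i t *: (v i)^T by rewrite linearZ.
  by rewrite trZ -scalemxAl -scalemxAr scalerA mxE /g /bform mulmx1.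
transitivity (\int[P]_t \sum_(ij : 'I_m * 'I_m)
    (U ij.1 t * U ij.2 t * g ij.1 ij.2)%R%:E)%E.
  by rewrite unlock; apply: eq_integral => t _; rewrite E sumEFin.
rewrite integral_sum//.
rewrite -(pair_bigA _ (fun i j => \int[P]_t (U i t * U j t * g i j)%R%:E)%E) /=.
apply: eq_bigr => i _; rewrite (bigD1 i)//= big1 ?adde0 => [|j ji].
  rewrite unlock; apply: eq_integral => t _.
  by rewrite sqr_enormZ -bform1 expr2.
by rewrite EUU orth ?mule0// eq_sym.
Qed.

Lemma mutually_independent_pair {R : realType} {d : measure_display}
    {T : measurableType d} {P : probability T R} {n : nat}
    (Y : 'I_n -> {RV P >-> R}) (i j : 'I_n) :
  mutually_independent Y -> i != j -> forall A B : set R,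
  measurable A -> measurable B ->
  P (Y i @^-1` A `&` Y j @^-1` B) = (P (Y i @^-1` A) * P (Y j @^-1` B))%E.
Proof.
move=> indepY ij A B mA mB.
have ji : (j == i) = false by rewrite eq_sym (negbTE ij).
(* Only the values of this family at [i] and [j] matter, and [i != j] makes the second one [B]. *)
have := indepY [set i; j]%SET (fun k => if k == i then A else B).
rewrite big_setU1 ?inE//= big_set1 eqxx ji => <-; last by move=> k; case: ifP.
congr (P _); apply/seteqP; split => [t [Ai Bj] k /=|t AB].
  by rewrite !inE => /orP[] /eqP ->; rewrite ?eqxx ?ji.
split.
  by have := AB i; rewrite /= eqxx !inE eqxx; exact.
by have := AB j; rewrite /= ji !inE eqxx orbT; exact.
Qed.

(** Under a probability, square integrability makes both variables and their product integrable; the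
    covariance is then E[Y_i Y_j] - E[Y_i] E[Y_j], and the product rule applies. *)
Lemma covariance_independent {R : realType} {d : measure_display}
    {T : measurableType d} {P : probability T R} {n : nat}
    (Y : 'I_n -> {RV P >-> R}) (i j : 'I_n) :
  mutually_independent Y -> i != j ->
  (Y i : T -> R) \in Lfun P 2%:E -> (Y j : T -> R) \in Lfun P 2%:E ->
  covariance P (Y i) (Y j) = 0%E.
Proof.
move=> indepY ij L2i L2j.
have L12 : {subset Lfun P 2%:E <= Lfun P 1} by apply: Lfun_subset12; exact: fin_num_measure.
have L1i := L12 _ L2i; have L1j := L12 _ L2j.
have L1ij := Lfun2_mul_Lfun1 L2i L2j.
rewrite covarianceE//.
have -> : ((Y i : T -> R) * Y j)%R = Y i \* Y j by [].
rewrite expectation_mul_independent//.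
  by rewrite subee// fin_numM// expectation_fin_num.
exact: mutually_independent_pair.
Qed.

(** * Deviation bound at a fixed sample size *)

Section subsample_deviation.
Context {R : realType} {p q n : nat} {d : measure_display}.
Context {T : measurableType d} (P : probability T R).
Context (F : R.-pker (covariate R p) ~> R) (s : p.-tuple R -> 'cV[R]_q).
Context (w : design R p n) (Y : 'I_n -> {mfun T >-> R}) (S : {set 'I_n}).
Hypothesis Y_indep : mutually_independent (P := P) Y.
Hypothesis Y_law : forall (i : 'I_n) (B : set R),
  measurable B -> distribution P (Y i) B = F (w i) B.

Let Z i := regressor s (w i).
Let mean i := cond_mean F (w i).
Let U i (t : T) := Y i t - mean i.

(** The intercept alone contributes 1. Through this bound, control of |Z U|^2 yields control of
    U^2. *)
Lemma sqr_enorm_regressor_ge1 (c : covariate R p) :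
  1 <= enorm (regressor s c) ^+ 2.
Proof.
rewrite sqr_enorm (bigD1 (lshift _ 0))//= col_mxEu mxE expr1n lerDl.
by rewrite sumr_ge0// => i _; exact: sqr_ge0.
Qed.

(** A change of variables through the law of [Y i]: it turns the moment condition on the kernel [F]
    into one on the sampled variables. *)
Lemma expectation_score i :
  'E_P[fun t => (enorm (U i t *: Z i) ^+ 2)%R]%E = cond_score2 s F (w i).
Proof.
pose f (y : R) := (enorm ((y - mean i) *: Z i) ^+ 2)%:E.
have mf : measurable_fun [set: R] f.
  apply/measurable_EFinP; under eq_fun do rewrite sqr_enormZ.
  apply: measurable_funM => //; apply: measurable_funX.
  exact: measurable_funB.
transitivity (\int[distribution P (Y i)]_y f y)%E.
  rewrite ge0_integral_distribution//; first by rewrite unlock.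
  by move=> y; rewrite lee_fin sqr_ge0.
by apply: eq_measure_integral => B mB _; exact: Y_law.
Qed.

Section bounded_score.
Variable M : R.
Hypothesis score_le : forall i, i \in S -> (cond_score2 s F (w i) <= M%:E)%E.

(** Since |Z| >= 1, U^2 <= |U Z|^2, whose expectation is at most [M]. Thus [U i] is square
    integrable, and [Y i] differs from it by a constant. *)
Lemma Lfun2_outcome i : i \in S -> (Y i : T -> R) \in Lfun P 2%:E.
Proof.
move=> iS.
have mU : measurable_fun [set: T] (U i) by exact: measurable_funB.
have L2U : U i \in Lfun P 2%:E.
  apply: integrable_sqr_Lfun2 => //; apply/integrableP; split.
    by apply/measurable_EFinP; exact: measurable_funX.
  apply: (@le_lt_trans _ _ M%:E); last exact: ltry.
  apply: le_trans (score_le i iS); rewrite -expectation_score unlock.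
  apply: ge0_le_integral => //.
  - by apply: measurableT_comp => //; apply/measurable_EFinP; exact: measurable_funX.
  - apply/measurable_EFinP; under eq_fun do rewrite sqr_enormZ.
    by apply: measurable_funM => //; exact: measurable_funX.
  - move=> t _; rewrite gee0_abs ?lee_fin ?sqr_ge0// sqr_enormZ.
    by rewrite ler_peMr ?sqr_ge0// sqr_enorm_regressor_ge1.
have -> : (Y i : T -> R) = U i \+ cst (mean i).
  by apply/funext => t; rewrite /U /= subrK.
by rewrite rpredD ?lee1n// => ?; exact: Lfun_cst.
Qed.

(** This identifies the centring of [U i] with the expectation of [Y i], so that E[U_i U_j] is a
    covariance. Integrability comes from the score bound. *)
Lemma cond_meanE i : i \in S -> mean i = fine 'E_P[Y i]%E.
Proof.
move=> iS; have L1Y : (Y i : T -> R) \in Lfun P 1.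
  by apply: Lfun_subset12; [exact: fin_num_measure|exact: Lfun2_outcome].
rewrite expectation_def /mean /cond_mean /Rintegral; congr fine.
transitivity (\int[distribution P (Y i)]_y y%:E)%E.
  by apply: eq_measure_integral => B mB _; rewrite -Y_law.
rewrite integral_distribution//; exact/Lfun1_integrable.
Qed.

(** The units of [S] are enumerated by ordinals to match [expectation_sqr_enorm_sum]. *)
Let v (j : 'I_#|S|) : 'cV[R]_(1 + (1 + q)) :=
  invmx (Gamma s w S) *m (#|S|%:R^-1 *: Z (enum_val j)).

Lemma theta_hatB (t : T) :
  theta_hat s w S (fun i => Y i t) - theta s w S F =
  \sum_(j < #|S|) U (enum_val j) t *: v j.
Proof.
rewrite /theta_hat /theta -mulmxBr -scalerBr -sumrB big_enum_val /=.
rewrite scaler_sumr mulmx_sumr; apply: eq_bigr => j _.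
by rewrite -scalerBl /v [RHS]scalemxAr !scalerA mulrC.
Qed.

Lemma measurable_enorm_theta_hatB : measurable_fun [set: T]
  (fun t => enorm (theta_hat s w S (fun i => Y i t) - theta s w S F)).
Proof.
under eq_fun do rewrite theta_hatB.
by apply: measurable_enorm_sum => j; exact: measurable_funB.
Qed.

Lemma expectation_sqr_enorm_theta_hatB_le (l : R) :
  0 < l -> l <= lambda_min (Gamma s w S) ->
  ('E_P[fun t => (enorm (theta_hat s w S (fun i => Y i t) - theta s w S F) ^+ 2)%R]
   <= (l ^- 2 * M / #|S|%:R)%:E)%E.
Proof.
move=> l0 lG.
have L2Y (j : 'I_#|S|) : (Y (enum_val j) : T -> R) \in Lfun P 2%:E.
  by apply: Lfun2_outcome; exact: enum_valP.
have mU i : measurable_fun [set: T] (U i) by exact: measurable_funB.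
under [X in ('E_P[X])%E]eq_fun do rewrite theta_hatB.
rewrite expectation_sqr_enorm_sum; first last.
- move=> i j ij.
  (* The cross moments of the [U i] are covariances of distinct outcomes, hence zero. *)
  have := covariance_independent Y (enum_val i) (enum_val j) Y_indep.
  rewrite (inj_eq enum_val_inj) => /(_ ij (L2Y i) (L2Y j)) <-.
  by rewrite covariance.unlock -!cond_meanE ?enum_valP.
- move=> j; have -> : U (enum_val j) = Y (enum_val j) \- cst (mean (enum_val j)) by [].
  by rewrite rpredB ?lee1n// => ?; exact: Lfun_cst.
(* The factor in |v_j|^2 <= c |Z_j|^2: [l ^- 2] comes from the inverse of [Gamma], the rest from the
   weight 1 / |S|. *)
pose c := l ^- 2 * #|S|%:R ^- 2.
have c_ge0 : 0 <= c by rewrite mulr_ge0// invr_ge0 sqr_ge0.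
have mZ i (z : 'cV[R]_(1 + (1 + q))) :
    measurable_fun [set: T] (fun t => (enorm (U i t *: z) ^+ 2)%:E).
  apply/measurable_EFinP; under eq_fun do rewrite sqr_enormZ.
  by apply: measurable_funM => //; exact: measurable_funX.
have score_v_le j :
    ('E_P[fun t => (enorm (U (enum_val j) t *: v j) ^+ 2)%R] <= (c * M)%:E)%E.
  have : (c%:E * 'E_P[fun t => (enorm (U (enum_val j) t *: Z (enum_val j)) ^+ 2)%R]
          <= (c * M)%:E)%E.
    rewrite (EFinM c M) expectation_score; apply: lee_wpmul2l; first by rewrite lee_fin.
    by apply: score_le; exact: enum_valP.
  apply: le_trans; rewrite unlock -ge0_integralZl//; last first.
    by move=> t _; rewrite lee_fin sqr_ge0.
  apply: ge0_le_integral => //.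
  - by move=> t _; rewrite lee_fin sqr_ge0.
  - exact: measurable_funeM.
  move=> t _; rewrite -EFinM lee_fin !sqr_enormZ [leRHS]mulrCA ler_wpM2l ?sqr_ge0//.
  rewrite (le_trans (sqr_enorm_invmx_le _ _ _ (psd_Gamma s w S) l0 lG))//.
  by rewrite sqr_enormZ exprVn /c mulrA.
apply: (@le_trans _ _ (\sum_(j < #|S|) (c * M)%:E)%E).
  by apply: lee_sum => j _; exact: score_v_le.
rewrite sumEFin sumr_const card_ord lee_fin -[_ *+ #|S|]mulr_natl /c.
(* For an empty subsample both sides are 0, as the inverse of 0 is 0. *)
have [->|m0] := eqVneq (#|S|%:R : R) 0; first by rewrite mul0r invr0 mulr0.
rewrite le_eqVlt; apply/orP; left; apply/eqP; field.
by rewrite m0 gt_eqF.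
Qed.

Lemma deviation_theta_hat_le (l eta : R) :
  0 < l -> l <= lambda_min (Gamma s w S) -> 0 < eta ->
  (P [set t | (eta < enorm (theta_hat s w S (fun i => Y i t) - theta s w S F))%R]
   <= (eta ^- 2 * (l ^- 2 * M / #|S|%:R))%:E)%E.
Proof.
move=> l0 lG eta0.
have mD := measurable_enorm_theta_hatB.
pose D : {RV P >-> R} :=
  MeasurableFun.Pack (MeasurableFun.Class (isMeasurableFun.Build _ _ _ _ _ mD)).
rewrite EFinM lee_pdivlMl ?exprn_gt0//.
apply: le_trans (expectation_sqr_enorm_theta_hatB_le l l0 lG).
(* Markov's inequality for the squared deviation, as in Chebyshev's inequality. *)
have := markov D (f := fun x => x ^+ 2) (eps := eta) eta0 (exprn_measurable 2) _ _.
have -> : (fun x : R => x ^+ 2) \o Num.norm \o D = (fun t => D t ^+ 2).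
  by apply/funext => t /=; rewrite real_normK ?num_real.
move=> mk; apply: le_trans (mk _ _); first last.
- by move=> x y; rewrite !nnegrE => x0 y0; exact: lerXn2r.
- by move=> r _; exact: sqr_ge0.
apply: lee_wpmul2l; first by rewrite lee_fin sqr_ge0.
(* Markov's inequality concerns the event [eta <= |D|], which contains the event [eta < D]. *)
apply: le_measure; rewrite ?inE.
- rewrite -[X in measurable X]setTI.
  exact: measurable_fun_ltr.
- rewrite -[X in measurable X]setTI; apply: emeasurable_fun_c_infty => //.
  by apply: measurableT_comp => //; exact/measurable_EFinP.
move=> t /= /ltW; rewrite lee_fin => /le_trans; apply; exact: ler_norm.
Qed.

End bounded_score.
End subsample_deviation.

(** * Passage to the limit in the sample size *)

(** The lower limit is the supremum, over neighbourhoods [V] of infinity, of the infimum of [u] on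
    [V]. Some such infimum exceeds [a], and so do all terms with index in that [V]. *)
Lemma limn_einf_gt_near {R : realType} (u : (\bar R)^nat) (a : \bar R) :
  (a < limn_einf u)%E -> \forall n \near \oo, (a < u n)%E.
Proof.
rewrite /limn_einf /limn_esup -/(limf_einf u \oo) limf_einfE.
move=> /ereal_sup_gt[_ [V nearV <-] aV]; apply: filterS nearV => n Vn.
by apply: (lt_le_trans aV); apply: ereal_inf_lbound; exists n.
Qed.

Theorem proposition2 (R : realType) (p q : nat)
  (* sampling framework: for each sample size n and each value w of the
     covariates of the n units, Pr n w is the conditional probability given w *)
  (disp : nat -> measure_display)
  (Omega : forall n : nat, measurableType (disp n))
  (F : forall n : nat, design R p n -> R.-pker (covariate R p) ~> R)
  (Pr : forall n : nat, design R p n -> probability (Omega n) R)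
  (Y : forall n : nat, 'I_n -> {mfun Omega n >-> R})
  (Y_indep : forall (n : nat) (w : design R p n),
     mutually_independent (P := Pr n w) (Y n))
  (Y_law : forall (n : nat) (w : design R p n) (i : 'I_n) (B : set R),
     measurable B -> distribution (Pr n w) (Y n i) B = F n w (w i) B)
  (* (1) *)
  (Sstar : forall n : nat, design R p n -> {set 'I_n})
  (s : forall n : nat, design R p n -> p.-tuple R -> 'cV[R]_q)
  (* the realizations *)
  (xd : forall n : nat, design R p n)
  (* (2) *)
  (Sstar_infty : (fun n : nat => #|Sstar n (xd n)|) @ \oo --> \oo)
  (* (3) *)
  (score_bounded : forall b : bool, exists M : R, forall (n : nat) (x : p.-tuple R),
     treatment_covariates (xd n) (Sstar n (xd n)) b x ->
     (cond_score2 (s n (xd n)) (F n (xd n)) (x, b) <= M%:E)%E)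
  (* (4) *)
  (Gamma_min : exists lambda : R, 0 < lambda /\
     (lambda%:E <= limn_einf (fun n : nat =>
        (lambda_min (Gamma (s n (xd n)) (xd n) (Sstar n (xd n))))%:E))%E) :
  forall eta : R, 0 < eta ->
    (fun n : nat => Pr n (xd n) [set omega : Omega n |
        eta < enorm (theta_hat (s n (xd n)) (xd n) (Sstar n (xd n))
                       (fun i : 'I_n => Y n i omega)
                     - theta (s n (xd n)) (xd n) (Sstar n (xd n)) (F n (xd n)))])
      @ \oo --> 0%E.
Proof.
move=> eta eta0.
have [lambda [lambda0 lambda_le]] := Gamma_min.
have [M0 score0] := score_bounded false; have [M1 score1] := score_bounded true.
(* One constant that bounds the scores of both treatment arms. *)
pose M := Num.max M0 M1.
have score_le n i : i \in Sstar n (xd n) ->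
    (cond_score2 (s n (xd n)) (F n (xd n)) (xd n i) <= M%:E)%E.
  move=> iS; rewrite (surjective_pairing (xd n i)).
  have mem b : (xd n i).2 = b ->
    treatment_covariates (xd n) (Sstar n (xd n)) b (xd n i).1 by move=> ib; exists i.
  case ib : (xd n i).2; [apply: le_trans (score1 _ _ (mem _ ib)) _
                       |apply: le_trans (score0 _ _ (mem _ ib)) _].
    by rewrite lee_fin le_max lexx orbT.
  by rewrite lee_fin le_max lexx.
(* A lower limit of at least [lambda] does not make the terms eventually at least [lambda], but they
   eventually exceed any smaller number; half of [lambda] stays positive. *)
pose l := lambda / 2.
have l0 : 0 < l by rewrite divr_gt0.
have l_near : \forall n \near \oo,
    l <= lambda_min (Gamma (s n (xd n)) (xd n) (Sstar n (xd n))).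
  have : (l%:E < limn_einf (fun n =>
      (lambda_min (Gamma (s n (xd n)) (xd n) (Sstar n (xd n))))%:E))%E.
    apply: lt_le_trans lambda_le; rewrite lte_fin /l; lra.
  by move=> /limn_einf_gt_near; apply: filterS => n; rewrite lte_fin => /ltW.
pose C := eta ^- 2 * (l ^- 2 * M).
(* The probability lies between 0 and C / |S*| as soon as [lambda_min] is at least [l], hence for
   all large [n]. *)
apply: (@squeeze_cvge _ _ _ _ (cst 0%E) _
  (fun n => (C * (#|Sstar n (xd n)|%:R)^-1)%:E)).
- apply: filterS l_near => n ln; rewrite measure_ge0 /= /C -!mulrA.
  have := deviation_theta_hat_le _ _ _ _ _ _ (Y_indep n (xd n)) (Y_law n (xd n)) M
    (score_le n) l eta l0 ln eta0.
  by rewrite -!mulrA.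
- exact: cvg_cst.
apply: cvg_EFin; first exact: nearW.
(* Positivity holds only eventually, since early subsamples may be empty. *)
have S_gt0 : \forall n \near \oo, 0 < (#|Sstar n (xd n)|%:R : R).
  by have /cvgnyPge/(_ 1%N) := Sstar_infty; apply: filterS => n; rewrite ltr0n.
have inv0 : (fun n => (#|Sstar n (xd n)|%:R : R)^-1) @ \oo --> (0 : R).
  by apply/(gtr0_cvgV0 S_gt0)/cvgrnyP.
by rewrite -[X in _ --> X](mulr0 C); apply: cvgM => //; exact: cvg_cst.
Qed.
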